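(* Consider the arc-reversal walk on the point-block incidence graph of a $(v,k,\lambda)$-design with $1<k<v$. There is peak state transfer starting at a vertex corresponding to a point (i.e. peak state transfer at some time from a vertex $x$ corresponding to a point of the design to some other vertex $y$ of the incidence graph) if and only if $v=3$ and $k=2$, or $v=9$ and $k=3$.
   Context: A block design with parameters $v,b,r,k,\lambda$ (a $(v,k,\lambda)$-design) is an incidence structure on a set $\mathcal{P}$ of $v$ points, together with a collection $\mathcal{B}$ of $b$ subsets of $\mathcal{P}$ of size $k$ (the blocks; repeated blocks are allowed), such that each point is in exactly $r$ blocks and each pair of distinct points is in exactly $\lambda\geq 1$ blocks. Throughout $1<k<v$; then $b$ and $r$ are determined by $v,k,\lambda$. The point-block incidence graph is the bipartite graph with vertex set $\mathcal{P}\sqcup\mathcal{B}$ in which a point and a block are adjacent if and only if the point lies in the block. Arc-reversal walk: let $G=(V,E)$ be a finite simple graph without isolated vertices and $\mathcal{A}$ its set of arcs (ordered pairs $(x,y)$ with $xy\in E$; $x$ is the tail). Let $N\in\mathbb{R}^{\mathcal{A}\times V}$ with $N(a,x)=1/\sqrt{d(x)}$ if $x$ is the tail of $a$ and $0$ otherwise ($d(x)$ is the degree), and let $R$ be the permutation matrix on $\mathcal{A}$ swapping $(x,y)$ and $(y,x)$. The transition matrix is $U=R(2NN^T-I)$. Put $B_t=N^TU^tN$ for integers $t\ge0$, and $B=B_1=D^{-1/2}AD^{-1/2}$, where $A$ is the adjacency matrix and $D$ the diagonal degree matrix. Let $B=\sum_\theta\theta E_\theta$ be the spectral decomposition ($\theta$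 over distinct eigenvalues, $E_\theta$ the orthogonal projection onto the $\theta$-eigenspace). For distinct vertices $x,y$ there is peak state transfer from $x$ to $y$ at time $t$ (a positive integer) if $|B_t(x,y)|=\sum_\theta|E_\theta(x,y)|$ and $E_\theta(x,y)\neq0$ for at least one $\theta$. *)

(* Defs.v *)
From mathcomp Require Import all_boot all_order all_algebra.
From mathcomp Require Import boolp classical_sets cardinality fsbigop reals.

Set Implicit Arguments.
Unset Strict Implicit.
Unset Printing Implicit Defensive.

Import Order.TTheory GRing.Theory Num.Theory.

Local Open Scope ring_scope.

(* Matrices with rows indexed by S and columns by T are 'M_(#|S|, #|T|),
   the indices being translated by enum_val and enum_rank. *)
Definition fmx (R : Type) (S T : finType) (F : S -> T -> R) :
    'M[R]_(#|S|, #|T|) :=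
  \matrix_(i, j) F (enum_val i) (enum_val j).

Definition fmx_entry (R : Type) (S T : finType) (M : 'M[R]_(#|S|, #|T|))
    (x : S) (y : T) : R :=
  M (enum_rank x) (enum_rank y).

(* Projection onto the row space of W along its orthogonal complement
   {u | u *m W^T = 0}; cf. spectral.proj_ortho, which is for complex scalars. *)
Definition orth_proj (R : realType) (n : nat) (W : 'M[R]_n) : 'M[R]_n :=
  proj_mx W (kermx W^T).

Section ArcReversalWalk.

(* The graph with adjacency relation e, meant to be symmetric, irreflexive and
   without isolated vertices. *)
Variables (R : realType) (V : finType) (e : rel V).

Definition degree (x : V) : nat := #|[set y | e x y]|.

Definition arc : finType := {a : V * V | e a.1 a.2}.

Definition arc_tail (a : arc) : V := (val a).1.

Definition arc_head (a : arc) : V := (val a).2.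

Definition tail_mx : 'M[R]_(#|arc|, #|V|) :=
  fmx (fun (a : arc) (x : V) =>
    if x == arc_tail a then (Num.sqrt (degree x)%:R)^-1 else 0).

Definition reversal_mx : 'M[R]_#|arc| :=
  fmx (fun a a' : arc =>
    ((arc_tail a' == arc_head a) && (arc_head a' == arc_tail a))%:R).

Definition transition_mx : 'M[R]_#|arc| :=
  reversal_mx *m (2%:R *: (tail_mx *m tail_mx^T) - 1%:M).

Definition walk_mx (t : nat) : 'M[R]_#|V| :=
  tail_mx^T *m (transition_mx ^+ t) *m tail_mx.

(* walk_mx 1 is symmetric, so its left eigenspaces (row vectors), which is what
   eigenspace denotes, are also its right eigenspaces. *)
Definition eigenprojection (theta : R) : 'M[R]_#|V| :=
  orth_proj (eigenspace (walk_mx 1) theta).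

(* The sum has finite support: there are finitely many eigenvalues. *)
Definition peak_state_transfer (x y : V) (t : nat) : Prop :=
  [/\ x != y, (0 < t)%N,
      `|fmx_entry (walk_mx t) x y| =
        \sum_(theta \in [set theta | eigenvalue (walk_mx 1) theta]%classic)
           `|fmx_entry (eigenprojection theta) x y|
    & exists2 theta : R, eigenvalue (walk_mx 1) theta
        & fmx_entry (eigenprojection theta) x y != 0].

End ArcReversalWalk.

(* Blocks are indexed by Bl so that they may be repeated. *)
Record block_design (P Bl : finType) (blk : Bl -> {set P})
    (v b r k lambda : nat) : Prop := BlockDesign {
  design_points : #|P| = v;
  design_blocks : #|Bl| = b;
  design_block_size : forall B : Bl, #|blk B| = k;
  design_point_degree : forall p : P, #|[set B | p \in blk B]| = r;
  design_pair_degree : forall p q : P, p != q ->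
    #|[set B | (p \in blk B) && (q \in blk B)]| = lambda;
  design_lambda_gt0 : (0 < lambda)%N }.

Definition incidence_graph (P Bl : finType) (blk : Bl -> {set P}) :
    rel (P + Bl)%type :=
  fun x y => match x, y with
  | inl p, inr B | inr B, inl p => p \in blk B
  | _, _ => false
  end.

(* Main.v *)
Require Import Defs.
From mathcomp Require Import all_boot all_order all_algebra reals.
From mathcomp Require Import boolp classical_sets fsbigop ring lra zify.

(** Write B for the normalised adjacency matrix and B_t for the compressed
    walk N^T U^t N.  Since R is an involution and N^T N = 1, the walk satisfies
    the three-term recursion B_(t+2) = 2 B_(t+1) B - B_t ([walk_mxSS]), so B_t
    is the t-th Chebyshev polynomial T_t of B.

    Fix a point x of a (v,k,lambda)-design.  The incidence matrix M satisfies
    M M^T = (r - lambda) I + lambda J, so the unit row vector at x is a sum of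
    four eigenvectors of B, with eigenvalues 1, -1, sigma, -sigma, where
    sigma^2 = (r - lambda) / (r k) = (v - k) / (k (v - 1))
    ([component_eigen], [component_sum]).  As B is symmetric, these vectors are
    the rows at x of the corresponding eigenprojections, and all other
    eigenprojections vanish on row x; hence peak state transfer from x to y
    reads |sum T_t(theta) w_theta(y)| = sum |w_theta(y)| over the four
    eigenvalues theta, where w_theta is the corresponding component
    ([peak_from_pointE]).

    Necessity.  Because |T_t| <= 1 on [-1,1], each w_theta(y) <> 0 forces
    |T_t(theta)| = 1 ([norm_sum_tight]).  The entry w_sigma(y) never vanishes
    for y <> x, so T_t(sigma)^2 = 1, that is T_t(2 sigma^2 - 1) = 1.
    Now 2 T_t(z / 2) is a monic polynomial in z with integer coefficients, so
    the rational number z = 4 sigma^2 - 2 is an integer (Niven's theorem,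
    [cheb_rational_eq1]).  Since 0 < sigma^2 < 1/2, this leaves
    4 sigma^2 = 1, i.e. 4 (v - k) = k (v - 1), whose only solutions with
    1 < k < v are (3,2) and (9,3) ([cheb_sigma_parameters]).

    Sufficiency.  In those two cases sigma = 1/2 and T_3(1/2) = -1, and every
    block y avoiding x receives peak state transfer from x at time 3
    ([peak_to_block_avoiding]). *)

Set Implicit Arguments.
Unset Strict Implicit.
Unset Printing Implicit Defensive.

Import Order.TTheory GRing.Theory Num.Theory.

(** * Chebyshev polynomials and Niven's theorem *)

Section Chebyshev.

Local Open Scope ring_scope.

(** The value at [x] of the Chebyshev polynomial of the first kind T_n, in an
    arbitrary ring. *)
Fixpoint cheb (A : pzRingType) (n : nat) (x : A) : A :=
  match n with
  | 0 => 1
  | 1 => x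
  | (n''.+1 as n').+1 => 2%:R * x * cheb n' x - cheb n'' x
  end.

Lemma chebSS (A : pzRingType) (n : nat) (x : A) :
  cheb n.+2 x = 2%:R * x * cheb n.+1 x - cheb n x.
Proof. by []. Qed.

Lemma nat_ind2 (P : nat -> Prop) :
  P 0%N -> P 1%N -> (forall n, P n -> P n.+1 -> P n.+2) -> forall n, P n.
Proof.
move=> P0 P1 PSS n.
suff [] : P n /\ P n.+1 by [].
by elim: n => [|n [Pn PSn]]; split=> //; apply: PSS.
Qed.

Lemma rmorph_cheb (A B : pzRingType) (f : {rmorphism A -> B}) (n : nat) (x : A) :
  f (cheb n x) = cheb n (f x).
Proof.
elim/nat_ind2: n => [||n IH0 IH1] //; first exact: rmorph1.
by rewrite !chebSS rmorphB !rmorphM rmorph_nat IH0 IH1.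
Qed.

Lemma cheb1r (A : pzRingType) (n : nat) : cheb n (1 : A) = 1.
Proof.
elim/nat_ind2: n => [||n IH0 IH1] //.
by rewrite chebSS IH0 IH1 !mulr1 mulr2n addrK.
Qed.

Lemma chebN (A : comPzRingType) (n : nat) (x : A) :
  cheb n (- x) = (-1) ^+ n * cheb n x.
Proof.
elim/nat_ind2: n => [||n IH0 IH1]; rewrite ?expr0 ?mul1r ?expr1 ?mulN1r //.
by rewrite !chebSS IH0 IH1 !exprS; ring.
Qed.

(** The identity (T_(n+1) - x T_n)^2 + (1 - x^2) T_n^2 = 1 - x^2, an
    algebraic form of sin^2 + cos^2 = 1.  It yields both the bound |T_n| <= 1
    on [-1,1] and the duplication formula. *)
Lemma cheb_invariant (A : comPzRingType) (n : nat) (x : A) :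
  (cheb n.+1 x - x * cheb n x) ^+ 2 + (1 - x ^+ 2) * cheb n x ^+ 2 = 1 - x ^+ 2.
Proof.
elim: n => [|n IH]; first by rewrite /=; ring.
by rewrite chebSS -[RHS]IH; ring.
Qed.

Lemma cheb_double (A : comPzRingType) (n : nat) (x : A) :
  cheb n (2%:R * x ^+ 2 - 1) = 2%:R * cheb n x ^+ 2 - 1.
Proof.
elim/nat_ind2: n => [||n IH0 IH1]; [by rewrite /=; ring | by [] |].
have I := cheb_invariant n x.
rewrite chebSS IH0 IH1 chebSS.
set a := cheb n x in I *; set c := cheb n.+1 x in I *.
(* The induction step holds up to four times the invariant. *)
have : 4%:R * ((c - x * a) ^+ 2 + (1 - x ^+ 2) * a ^+ 2 - (1 - x ^+ 2)) = 0
  by rewrite I subrr mulr0.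
move=> E; rewrite -[LHS]addr0 -E; ring.
Qed.

Lemma cheb_le1 (A : realFieldType) (n : nat) (x : A) :
  `|x| <= 1 -> `|cheb n x| <= 1.
Proof.
rewrite le_eqVlt => /orP[/eqP x1|x1].
  have [->|->] : x = 1 \/ x = -1.
  - by move: x1; have [_|_] := ger0P x => x1; [left|right]; lra.
  - by rewrite cheb1r normr1.
  by rewrite chebN cheb1r mulr1 normrX normrN1 expr1n.
have x2 : 0 < 1 - x ^+ 2 by rewrite subr_gt0 -real_normK ?num_real // expr_lt1.
have h : (1 - x ^+ 2) * cheb n x ^+ 2 <= (1 - x ^+ 2) * 1.
  by rewrite mulr1 -[X in _ <= X](cheb_invariant n x) lerDr sqr_ge0.
rewrite ler_pM2l // in h.
by rewrite -(@expr_le1 _ 2) // real_normK ?num_real.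
Qed.

(** Clearing denominators: q^n 2 T_n(p / 2q) is an integer, congruent to p^n
    modulo q because 2 T_n(z / 2) is monic in z.  For n = 0 the integer is 2,
    not congruent to p^0, whence the restriction to positive n. *)
Lemma cheb_scaled (p q : int) (n : nat) : q != 0 ->
  exists m : int, (m%:~R : rat) =
      q%:~R ^+ n * (2%:R * cheb n (p%:~R / (2%:R * q%:~R)))
    /\ ((n > 0)%N -> (q %| m - p ^+ n)%Z).
Proof.
move=> q0; have q0' : (q%:~R : rat) != 0 by rewrite intr_eq0.
elim/nat_ind2: n => [||n [m0 [E0 _]] [m1 [E1 /(_ isT) D1]]].
- by exists 2; split=> //; rewrite /= expr0 mul1r mulr1.
- exists p; split; last by rewrite expr1 subrr dvdz0.
  by rewrite /= expr1; field.
exists (p * m1 - q ^+ 2 * m0); split.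
  rewrite chebSS; move: E0 E1; set c0 := cheb n _; set c1 := cheb n.+1 _.
  rewrite [q ^+ 2]expr2 rmorphB !rmorphM /= !exprS => -> ->.
  by field.
move=> _.
have -> : p * m1 - q ^+ 2 * m0 - p ^+ n.+2
   = p * (m1 - p ^+ n.+1) - q * (q * m0) by rewrite [p ^+ n.+2]exprS; ring.
by rewrite rpredB //; [exact: dvdz_mull | rewrite dvdz_mulr].
Qed.

(** Niven's theorem: z / 2 is here the cosine of a rational multiple of pi. *)
Lemma cheb_rational_eq1 (z : rat) (n : nat) : (0 < n)%N ->
  cheb n (z / 2%:R) = 1 -> z \is a Num.int.
Proof.
move=> n0 E.
have [m [Em /(_ n0) D]] := cheb_scaled (numq z) n (denq_neq0 z).
have zE : (numq z)%:~R / (2%:R * (denq z)%:~R) = z / 2%:R :> rat.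
  rewrite -{3}(divq_num_den z); field.
  by rewrite intr_eq0 denq_neq0.
rewrite zE E mulr1 -rmorphXn /= in Em.
have {}Em : m = denq z ^+ n * 2.
  by apply: (@intr_inj rat); rewrite Em rmorphM /=.
(* The denominator divides a power of the numerator, so it is 1. *)
have Dp : (denq z %| numq z ^+ n)%Z.
  rewrite -[numq z ^+ n](subKr m) rpredB // Em.
  by apply: dvdz_mulr; apply: dvdz_exp.
have C : coprimez (denq z) (numq z ^+ n).
  by rewrite coprimezXr // /coprimez gcdzC; apply/eqP; congr Posz;
     apply/eqP; exact: coprime_num_den.
rewrite Qint_def -(ger0_norm (denq_ge0 z)).
have : (denq z %| gcdz (denq z) (numq z ^+ n))%Z by rewrite dvdz_gcd dvdzz.
by rewrite (eqP C) dvdz1 -abszE => /eqP->.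
Qed.

End Chebyshev.

(** * Orthogonal projections on the eigenspaces of a symmetric matrix *)

Section SymmetricEigenprojections.

Local Open Scope ring_scope.

Variables (R : realType) (n : nat).
Implicit Types (B W : 'M[R]_n) (u w : 'rV[R]_n).

Lemma rV_dot_eq0 u : u *m u^T = 0 -> u = 0.
Proof.
move/matrixP/(_ 0 0); rewrite !mxE => /eqP.
under eq_bigr do rewrite mxE -expr2.
rewrite psumr_eq0 => [/allP u0|i _]; last exact: sqr_ge0.
apply/rowP => j; rewrite mxE; apply/eqP.
by have := u0 j (mem_index_enum _); rewrite sqrf_eq0.
Qed.

Lemma capmx_kermx_tr W : (W :&: kermx W^T = 0)%MS.
Proof.
apply/eqP/rowV0P => u; rewrite sub_capmx => /andP[/submxP[a ->] /sub_kermxP H].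
by apply: rV_dot_eq0; rewrite trmx_mul mulmxA H mul0mx.
Qed.

(** Eigenvectors of a symmetric matrix for distinct eigenvalues are orthogonal,
    so the orthogonal projection on an eigenspace fixes or kills any given
    eigenvector. *)
Lemma orth_proj_eigenspace B (theta theta' : R) w :
  B^T = B -> w *m B = theta *: w ->
  w *m orth_proj (eigenspace B theta') = if theta == theta' then w else 0.
Proof.
move=> symB wB; have cap0 := capmx_kermx_tr (eigenspace B theta').
case: eqVneq => [<-|neq].
  by apply: proj_mx_id; [exact: capmx_kermx_tr | exact/eigenspaceP].
apply: proj_mx_0 => //; apply/sub_kermxP.
set W := eigenspace B theta'.
have WB : W *m B = theta' *: W by apply/eigenspaceP.
have : (theta - theta') *: (w *m W^T) = 0.
  rewrite scalerBl scalemxAl -wB -mulmxA -{1}symB -trmx_mul WB linearZ /=.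
  by rewrite -scalemxAr subrr.
by move/eqP; rewrite scaler_eq0 subr_eq0 (negPf neq) => /eqP.
Qed.

End SymmetricEigenprojections.

(** * Matrices indexed by finite types *)

Section FinTypeMatrices.

Local Open Scope ring_scope.

Variable R : pzRingType.

Lemma mulmx_fmx (S T U : finType) (F : S -> T -> R) (G : T -> U -> R) :
  fmx F *m fmx G = fmx (fun x z => \sum_y F x y * G y z).
Proof.
apply/matrixP => i j; rewrite !mxE [RHS]big_enum_val.
by apply: eq_bigr => k _; rewrite !mxE.
Qed.

Lemma eq_fmx (S T : finType) (F G : S -> T -> R) :
  (forall x y, F x y = G x y) -> fmx F = fmx G.
Proof. by move=> FG; apply/matrixP => i j; rewrite !mxE. Qed.

Lemma trmx_fmx (S T : finType) (F : S -> T -> R) :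
  (fmx F)^T = fmx (fun y x => F x y).
Proof. by apply/matrixP => i j; rewrite !mxE. Qed.

Lemma fmx1 (S : finType) : fmx (fun x y : S => (x == y)%:R) = 1%:M :> 'M[R]__.
Proof.
by apply/matrixP => i j; rewrite !mxE (inj_eq enum_val_inj).
Qed.

Lemma fmx_entry_row (S T : finType) (M : 'M[R]_(#|S|, #|T|)) (x : S) (y : T) :
  fmx_entry M x y = row (enum_rank x) M 0 (enum_rank y).
Proof. by rewrite [RHS]mxE. Qed.

End FinTypeMatrices.

(** * The arc-reversal walk *)

Section Walk.

Local Open Scope ring_scope.

Variables (R : realType) (V : finType) (e : rel V).
Hypothesis e_sym : symmetric e.
Hypothesis deg_gt0 : forall x, (0 < degree e x)%N.

Local Notation N := (tail_mx R e).
Local Notation Rev := (reversal_mx R e).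
Local Notation U := (transition_mx R e).
Local Notation B := (walk_mx R e).

Lemma sum_arc (F : V -> V -> R) :
  \sum_(a : Defs.arc e) F (arc_tail a) (arc_head a) = \sum_x \sum_(y | e x y) F x y.
Proof.
rewrite pair_big_dep /=.
by rewrite (big_sub (fun p : V * V => e p.1 p.2) (fun p => F p.1 p.2)).
Qed.

Lemma tail_mx_isometry : N^T *m N = 1%:M.
Proof.
rewrite trmx_fmx mulmx_fmx -fmx1; apply: eq_fmx => x z.
pose F (y y' : V) := (if x == y then (Num.sqrt (degree e x)%:R)^-1 else 0) *
  (if z == y then (Num.sqrt (degree e z)%:R)^-1 else 0) : R.
rewrite (sum_arc F) (bigD1 x) //= [X in _ + X]big1 ?addr0 => [|y yx]; last first.
  by apply: big1 => y' _; rewrite /F eq_sym (negPf yx) mul0r.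
rewrite /F eqxx eq_sym; case: (eqVneq x z) => [<-|_]; last first.
  by rewrite big1 // => y _; rewrite mulr0.
rewrite sumr_const; set c := #|_|; have -> : c = degree e x.
  by apply: eq_card => y; rewrite inE.
rewrite -[LHS]mulr_natr -expr2 exprVn sqr_sqrtr ?ler0n // mulVf //.
by rewrite pnatr_eq0 -lt0n.
Qed.

(** The arc [a] traversed backwards. *)
Definition arc_rev (a : Defs.arc e) : Defs.arc e :=
  exist _ ((val a).2, (val a).1) (etrans (e_sym _ _) (valP a)).

Lemma arc_revP (a a' : Defs.arc e) :
  ((arc_tail a' == arc_head a) && (arc_head a' == arc_tail a)) = (a' == arc_rev a).
Proof.
case: a a' => [[x y] exy] [[x' y'] exy'].
by rewrite -val_eqE /= /arc_tail /arc_head /= xpair_eqE.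
Qed.

Lemma arc_revK : involutive arc_rev.
Proof. by case=> [[x y] exy]; apply: val_inj. Qed.

Lemma reversal_mxE : Rev = fmx (fun a a' => (a' == arc_rev a)%:R).
Proof. by apply: eq_fmx => a a'; rewrite arc_revP. Qed.

Lemma reversal_mxK : Rev *m Rev = 1%:M.
Proof.
rewrite reversal_mxE mulmx_fmx -fmx1; apply: eq_fmx => a c.
rewrite (bigD1 (arc_rev a)) //= big1 ?addr0 => [|a' /negPf->]; last by rewrite mul0r.
by rewrite eqxx mul1r arc_revK eq_sym.
Qed.

Lemma trmx_reversal : Rev^T = Rev.
Proof.
rewrite trmx_fmx; apply: eq_fmx => a a'.
by rewrite andbC eq_sym [X in _ && X]eq_sym.
Qed.

Lemma transition_tail : U *m N = Rev *m N.
Proof.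
rewrite /transition_mx -mulmxA mulmxBl mul1mx -scalemxAl -mulmxA.
by rewrite tail_mx_isometry mulmx1 mulr2n scalerDl scale1r addrK.
Qed.

Lemma walk_mx1 : B 1 = N^T *m Rev *m N.
Proof. by rewrite /walk_mx expr1 -mulmxA transition_tail mulmxA. Qed.

Lemma walk_mx0 : B 0 = 1%:M.
Proof. by rewrite /walk_mx expr0 mulmx1 tail_mx_isometry. Qed.

(** The recursion of the Chebyshev polynomials, evaluated at [B 1]. *)
Lemma walk_mxSS t : B t.+2 = 2%:R *: (B t.+1 *m B 1) - B t.
Proof.
have UUN : U *m (U *m N) = 2%:R *: (U *m N *m B 1) - N.
  rewrite transition_tail walk_mx1 [U]/transition_mx -!mulmxA mulmxBl mul1mx.
  rewrite mulmxBr -scalemxAl -scalemxAr -!mulmxA.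
  by rewrite [Rev *m (Rev *m _)]mulmxA reversal_mxK mul1mx.
(* The transition matrix is generalised so that reassociating products does
   not unfold it. *)
move: (B 1) UUN => B1; rewrite /walk_mx; move: U => u UUN.
have uS n : u ^+ n.+1 = u ^+ n *m u by rewrite exprSr.
rewrite !uS -!mulmxA UUN mulmxBr mulmxBr -!scalemxAr.
by rewrite !mulmxA.
Qed.

Lemma walk_mx_sym : (B 1)^T = B 1.
Proof. by rewrite walk_mx1 !trmx_mul trmxK trmx_reversal mulmxA. Qed.

Lemma walk_mx1E : B 1 = fmx (fun x y =>
   if e x y then (Num.sqrt (degree e x)%:R)^-1 * (Num.sqrt (degree e y)%:R)^-1 else 0).
Proof.
rewrite walk_mx1 reversal_mxE -mulmxA mulmx_fmx trmx_fmx mulmx_fmx.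
apply: eq_fmx => x z.
pose F (y y' : V) := (if x == y then (Num.sqrt (degree e x)%:R)^-1 else 0) *
  (if z == y' then (Num.sqrt (degree e z)%:R)^-1 else 0) : R.
transitivity (\sum_(a : Defs.arc e) F (arc_tail a) (arc_head a)).
  apply: eq_bigr => a _; rewrite (bigD1 (arc_rev a)) //= eqxx mul1r.
  by rewrite big1 ?addr0 // => a' /negPf->; rewrite mul0r.
rewrite sum_arc (bigD1 x) //= [X in _ + X]big1 ?addr0 => [|y yx]; last first.
  by apply: big1 => y' _; rewrite /F eq_sym (negPf yx) mul0r.
case: ifP => exz.
  rewrite (bigD1 z) //= /F !eqxx big1 ?addr0 // => y /andP[_ /negPf zy].
  by rewrite eq_sym zy mulr0.
apply: big1 => y exy; rewrite /F; case: (eqVneq z y) => [zy|_]; last by rewrite mulr0.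
by rewrite zy exy in exz.
Qed.

Lemma eigenvector_walk (theta : R) (w : 'rV_#|V|) t :
  w *m B 1 = theta *: w -> w *m B t = cheb t theta *: w.
Proof.
move=> wB; elim/nat_ind2: t => [||t IH0 IH1] //.
  by rewrite walk_mx0 mulmx1 scale1r.
rewrite walk_mxSS chebSS mulmxBr -scalemxAr mulmxA IH1 -scalemxAl wB IH0.
by rewrite !scalerA scalerBl; congr (_ *: _ - _); ring.
Qed.

(** In this part the unit row vector at [x] is a sum of eigenvectors [w theta]
    of [B 1] for distinct [theta].  The list [s] need not contain the whole
    spectrum: eigenvalues outside it have an eigenprojection that vanishes on
    row [x].  Nor need all its members be eigenvalues, as [w theta] may be
    zero. *)
Section Decomposition.

Variables (s : seq R) (w : R -> 'rV[R]_#|V|) (x : V).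
Hypothesis s_uniq : uniq s.
Hypothesis w_eigen : forall theta, theta \in s -> w theta *m B 1 = theta *: w theta.
Hypothesis w_sum : \sum_(theta <- s) w theta = row (enum_rank x) 1%:M.

Lemma row_walk_mx t : row (enum_rank x) (B t) = \sum_(theta <- s) cheb t theta *: w theta.
Proof.
rewrite rowE -row1 -w_sum mulmx_suml.
by apply: eq_big_seq => theta /w_eigen; apply: eigenvector_walk.
Qed.

Lemma row_eigenprojection theta :
  row (enum_rank x) (eigenprojection e theta) = if theta \in s then w theta else 0.
Proof.
rewrite rowE -row1 -w_sum mulmx_suml.
transitivity (\sum_(i <- s) if i == theta then w i else 0).
  by apply: eq_big_seq => i /w_eigen /(orth_proj_eigenspace theta walk_mx_sym)->.
case: ifP => sth.
  rewrite (bigD1_seq theta) //= eqxx big1 ?addr0 // => i /negPf->//.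
by apply: big1_seq => i /andP[_ si]; case: eqP => // E; rewrite -E si in sth.
Qed.

(** Peak state transfer from [x] expressed through the components of row [x]. *)
Lemma peak_state_transferE y t :
  peak_state_transfer R e x y t <->
  [/\ x != y, (0 < t)%N,
      `|\sum_(theta <- s) cheb t theta * w theta 0 (enum_rank y)| =
        \sum_(theta <- s) `|w theta 0 (enum_rank y)|
    & exists2 theta, theta \in s & w theta 0 (enum_rank y) != 0].
Proof.
have BE : fmx_entry (B t) x y =
    \sum_(theta <- s) cheb t theta * w theta 0 (enum_rank y).
  by rewrite fmx_entry_row row_walk_mx summxE; apply: eq_bigr => i _; rewrite mxE.
have EE theta : fmx_entry (eigenprojection e theta) x y =
    if theta \in s then w theta 0 (enum_rank y) else 0.
  by rewrite fmx_entry_row row_eigenprojection; case: ifP => _; rewrite ?mxE.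
have ev theta : theta \in s -> w theta 0 (enum_rank y) != 0 ->
    eigenvalue (B 1) theta.
  move=> sth wy; apply/eigenvalueP; exists (w theta); first exact: w_eigen.
  by apply: contraNneq wy => ->; rewrite mxE.
have SE : \sum_(theta \in [set theta | eigenvalue (B 1) theta]%classic)
           `|fmx_entry (eigenprojection e theta) x y| =
    \sum_(theta <- s) `|w theta 0 (enum_rank y)|.
  rewrite fsbig_supp (@fsbig_fwiden _ _ _ _ s) //.
  - by apply: eq_big_seq => theta sth; rewrite EE sth.
  - move=> theta [_ /=]; rewrite EE; case: ifP => //= _.
    by rewrite normr0.
  - move=> theta [/= sth /not_andP[nev|/contrapT]//].
    rewrite EE sth; case: (eqVneq (w theta 0 (enum_rank y)) 0) => [->|wy].
      by rewrite normr0.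
    by case: nev; apply: ev.
rewrite /peak_state_transfer BE SE; split=> -[xy t0 E [theta]].
  rewrite EE; case: ifP; last by rewrite eqxx.
  by move=> sth _ wy; split=> //; exists theta.
move=> sth wy; split=> //; exists theta; first exact: ev.
by rewrite EE sth.
Qed.

End Decomposition.
End Walk.

(** * Equality in the triangle inequality *)

Section NormSum.

Local Open Scope ring_scope.

Lemma norm_sum_tight (R : realFieldType) (I : eqType) (s : seq I) (c w : I -> R) :
  (forall i, i \in s -> `|c i| <= 1) ->
  `|\sum_(i <- s) c i * w i| = \sum_(i <- s) `|w i| ->
  forall i, i \in s -> w i != 0 -> `|c i| = 1.
Proof.
move=> c1 E i si wi.
have pos j : j \in s -> 0 <= `|w j| - `|c j * w j|.
  by move=> /c1 cj; rewrite subr_ge0 normrM ler_piMl.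
have le0 : \sum_(j <- s) (`|w j| - `|c j * w j|) <= 0.
  by rewrite big_split sumrN /= -E subr_le0 ler_norm_sum.
have ge0 : 0 <= \sum_(j <- s) (`|w j| - `|c j * w j|).
  by rewrite big_seq sumr_ge0.
have : \sum_(j <- s | j \in s) (`|w j| - `|c j * w j|) == 0.
  by rewrite -big_seq eq_le le0.
rewrite psumr_eq0 // => /allP/(_ i si); rewrite si /= normrM subr_eq0.
rewrite -{1}[`|w i|]mul1r => /eqP/mulIf -> //.
by rewrite normr_eq0.
Qed.

End NormSum.

(** * Block designs *)

Section Designs.

Variables (P Bl : finType) (blk : Bl -> {set P}) (v b r k lambda : nat).
Hypothesis design : block_design blk v b r k lambda.
Hypothesis k_bounds : 1 < k < v.

Lemma incidence_graph_sym : symmetric (incidence_graph blk).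
Proof. by case=> [p|B] [q|C]. Qed.

Lemma degree_point p : degree (incidence_graph blk) (inl p) = r.
Proof.
rewrite -(design_point_degree design p) /degree -(card_imset _ (@inr_inj P Bl)).
apply: eq_card => -[q|B]; rewrite !inE /=.
  by apply/esym/imsetP => -[].
by rewrite (mem_imset _ _ (@inr_inj P Bl)) inE.
Qed.

Lemma degree_block B : degree (incidence_graph blk) (inr B) = k.
Proof.
rewrite -(design_block_size design B) /degree -(card_imset _ (@inl_inj P Bl)).
apply: eq_card => -[q|C]; rewrite !inE /=.
  by rewrite (mem_imset _ _ (@inl_inj P Bl)).
by apply/esym/imsetP => -[].
Qed.

Lemma sum_point_pairs p q :
  \sum_B (p \in blk B) * (q \in blk B) = if p == q then r else lambda.
Proof.
transitivity #|[set B | (p \in blk B) && (q \in blk B)]|.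
  rewrite -sum1dep_card [RHS]big_mkcond /=; apply: eq_bigr => B _.
  by case: (p \in _); case: (q \in _).
case: eqVneq => [<-|pq]; last exact: design_pair_degree design _ _ pq.
rewrite -(design_point_degree design p).
by apply: eq_card => B; rewrite !inE andbb.
Qed.

(** Double counting of the pairs (q, B) with [p] and [q] in [B], for a fixed
    point [p]. *)
Lemma design_count : r * k = r + lambda * v.-1.
Proof.
have vP := design_points design.
have /card_gt0P[p _] : 0 < #|P| by rewrite vP; lia.
transitivity (\sum_q \sum_B (p \in blk B) * (q \in blk B)).
  rewrite exchange_big /= -(design_point_degree design p) -sum1dep_card.
  rewrite big_distrl big_mkcond /=; apply: eq_bigr => B _.
  rewrite -big_distrr /= -(design_block_size design B) -sum1_card mul1n.
  by case: (p \in _); rewrite ?mul1n ?mul0n // [LHS]big_mkcond.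
rewrite (bigD1 p) //= sum_point_pairs eqxx; congr (_ + _).
rewrite (eq_bigr (fun=> lambda)) => [|q qp]; last first.
  by rewrite sum_point_pairs eq_sym (negPf qp).
rewrite sum_nat_const mulnC; congr (_ * _).
by rewrite -vP -(cardC1 p).
Qed.

Lemma lambda_lt_r : lambda < r.
Proof.
have := design_count; have := design_lambda_gt0 design.
by case: v k k_bounds => [|v'] [|k'] //=; nia.
Qed.

Lemma degree_gt0 x : 0 < degree (incidence_graph blk) x.
Proof.
case: x => [p|B]; rewrite ?degree_point ?degree_block.
  by have := lambda_lt_r; lia.
by lia.
Qed.

Lemma exists_block_avoiding x : exists B, x \notin blk B.
Proof.
apply/existsP; rewrite -negb_forall; apply/negP => /forallP all_x.
have vP := design_points design.
have /card_gt0P[q] : 0 < #|[set~ x]| by rewrite cardsC1 vP; lia.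
rewrite !inE eq_sym => xq.
(* If [x] lay in every block, each block through [q] would contain both
   points, so r would be at most lambda. *)
have := lambda_lt_r; rewrite -(design_point_degree design q).
rewrite -(design_pair_degree design xq) ltnNge => /negP[].
by apply: subset_leq_card; apply/fintype.subsetP => B; rewrite !inE all_x.
Qed.

(** * Eigenvectors of the incidence graph *)

Section Eigenvectors.

Local Open Scope ring_scope.

Variable R : realType.

Local Notation B1 := (walk_mx R (incidence_graph blk) 1).

(** The row vector whose entries are the values of a function on vertices. *)
Definition vertex_row (f : P + Bl -> R) : 'rV[R]_#|{: P + Bl}| :=
  \row_j f (enum_val j).

Lemma vertex_rowE f y : vertex_row f 0 (enum_rank y) = f y.
Proof. by rewrite mxE enum_rankK. Qed.

(** The normalising factor: [B1] has entries 1/s on incident pairs. *)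
Let s : R := Num.sqrt (r * k)%:R.

Lemma sqr_s : s ^+ 2 = (r * k)%:R.
Proof. by rewrite sqr_sqrtr ?ler0n. Qed.

Lemma s_gt0 : 0 < s.
Proof. by rewrite sqrtr_gt0 ltr0n; have := lambda_lt_r; nia. Qed.

Lemma vertex_row_walk f : vertex_row f *m B1 =
  vertex_row (fun y => match y with
    | inl q => s^-1 * \sum_(B | q \in blk B) f (inr B)
    | inr B => s^-1 * \sum_(p in blk B) f (inl p)
    end).
Proof.
rewrite (walk_mx1E R incidence_graph_sym degree_gt0).
have sE : (Num.sqrt r%:R)^-1 * (Num.sqrt k%:R)^-1 = s^-1 :> R.
  by rewrite /s natrM sqrtrM ?ler0n // invfM.
apply/rowP => j; rewrite !mxE.
transitivity (\sum_x f x * (if incidence_graph blk x (enum_val j) then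
    (Num.sqrt (degree (incidence_graph blk) x)%:R)^-1 *
    (Num.sqrt (degree (incidence_graph blk) (enum_val j))%:R)^-1 else 0)).
  by rewrite [RHS]big_enum_val; apply: eq_bigr => i _; rewrite !mxE.
rewrite big_sumType /=.
case: (enum_val j) => [q|B] /=.
  rewrite big1 ?add0r => [|p _]; last by rewrite mulr0.
  rewrite mulr_sumr [RHS]big_mkcond /=; apply: eq_bigr => B _.
  by case: ifP => _; rewrite ?mulr0 // degree_point degree_block -sE; ring.
rewrite [X in _ + X]big1 ?addr0 => [|p _]; last by rewrite mulr0.
rewrite mulr_sumr [RHS]big_mkcond /=; apply: eq_bigr => p _.
by case: ifP => _; rewrite ?mulr0 // degree_point degree_block -sE mulrC.
Qed.

(** Half of the extension of a function [u] on points to a candidate eigenvector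
    of [B1] for [theta]: if [u] is an eigenvector of M M^T for r k theta^2, its
    value on blocks must be u M / (theta sqrt(r k)).  The factor 1/2 makes the
    lifts for [theta] and [- theta] add up to [u] on points and 0 on blocks. *)
Definition lift_point_function (theta : R) (u : P -> R) (y : P + Bl) : R :=
  match y with
  | inl q => u q / 2%:R
  | inr B => (\sum_(p in blk B) u p) / (2%:R * theta * s)
  end.

(** The identity M M^T = (r - lambda) I + lambda J. *)
Lemma sum_blocks_through (u : P -> R) q :
  \sum_(B | q \in blk B) \sum_(p in blk B) u p =
    lambda%:R * (\sum_p u p) + (r%:R - lambda%:R) * u q.
Proof.
transitivity (\sum_p (\sum_B (p \in blk B) * (q \in blk B))%N%:R * u p).
  rewrite big_mkcond /=.
  under [RHS]eq_bigr do rewrite natr_sum mulr_suml.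
  rewrite [RHS]exchange_big /=; apply: eq_bigr => B _.
  case: (q \in blk B); last by rewrite big1 // => p _; rewrite muln0 mul0r.
  rewrite big_mkcond /=; apply: eq_bigr => p _.
  by case: (p \in blk B); rewrite ?mul1r ?mul0r.
rewrite mulr_sumr [LHS](bigD1 q) // [X in _ = X + _](bigD1 q) //=.
rewrite sum_point_pairs eqxx [X in _ = _ + X + _](eq_bigr
  (fun p => (\sum_B (p \in blk B) * (q \in blk B))%N%:R * u p)).
  by ring.
by move=> p /negPf pq; rewrite sum_point_pairs pq.
Qed.

Lemma lift_eigenvector (theta : R) (u : P -> R) : theta != 0 ->
  (forall q, \sum_(B | q \in blk B) \sum_(p in blk B) u p =
             (r * k)%:R * theta ^+ 2 * u q) ->
  vertex_row (lift_point_function theta u) *m B1 =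
    theta *: vertex_row (lift_point_function theta u).
Proof.
move=> th0 uE; have s0 : s != 0 by rewrite gt_eqF ?s_gt0.
rewrite vertex_row_walk; apply/rowP => j; rewrite !mxE.
case: (enum_val j) => [q|B] /=.
  rewrite -mulr_suml uE -sqr_s; field.
  by rewrite th0 s0.
by rewrite -mulr_suml; field; rewrite th0 s0.
Qed.

(** The eigenvalue sqrt((r - lambda) / (r k)) of [B1], written in terms of v and
    k only; see [rk_sigma]. *)
Definition sigma : R := Num.sqrt ((v - k)%:R / (k * v.-1)%:R).

Lemma sqr_sigma : sigma ^+ 2 = (v - k)%:R / (k * v.-1)%:R.
Proof. by rewrite sqr_sqrtr // divr_ge0 ?ler0n. Qed.

Lemma sigma_gt0 : 0 < sigma.
Proof. by rewrite sqrtr_gt0 divr_gt0 // ltr0n; nia. Qed.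

Lemma sigma_lt1 : sigma < 1.
Proof.
rewrite -(@ltr_pXn2r _ 2) ?nnegrE ?ler01 ?(ltW sigma_gt0) // sqr_sigma expr1n.
have kv : (0 < k * v.-1)%N by nia.
have vk : (v - k < k * v.-1)%N.
  have : (v.-1 <= k * v.-1)%N by apply: leq_pmull; lia.
  lia.
by rewrite ltr_pdivrMr ?ltr0n // mul1r ltr_nat.
Qed.

Lemma rk_sigma : (r * k)%:R * sigma ^+ 2 = r%:R - lambda%:R.
Proof.
rewrite sqr_sigma; have C := design_count; have lr := lambda_lt_r.
have kv0 : (k * v.-1)%:R != 0 :> R by rewrite pnatr_eq0; nia.
apply: (mulIf kv0); rewrite -natrB ?(ltnW lr) // mulrA divfK //.
rewrite -!natrM; congr _%:R.
have L : (lambda * v.-1 = r * k.-1)%N.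
  by rewrite -(addKn r (lambda * _)%N) -C -subn1 mulnBr muln1.
have vk : (v.-1 - k.-1 = v - k)%N by lia.
by rewrite [RHS]mulnCA mulnBl L -mulnBr vk mulnA [(k * r)%N]mulnC.
Qed.

Variable x : P.

(** The indicator function of [x] is the constant 1/v plus a function of sum
    zero.  The first summand lifts to the eigenvalues 1 and -1, the second to
    [sigma] and [- sigma]. *)
Definition point_part (theta : R) (p : P) : R :=
  if theta ^+ 2 == 1 then v%:R^-1 else (p == x)%:R - v%:R^-1.

(** The eigenvalues whose eigenprojection is nonzero on the rows of points; the
    kernel of [B1] is supported on the blocks. *)
Definition spectrum_on_points : seq R := [:: 1; -1; sigma; - sigma].

(** The component of the unit row vector at [x] in the eigenspace of [theta],
    for [theta] in [spectrum_on_points]. *)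
Definition component (theta : R) : 'rV[R]_#|{: P + Bl}| :=
  vertex_row (lift_point_function theta (point_part theta)).

Lemma sqr_sigma_neq1 : (sigma ^+ 2 == 1) = false.
Proof.
by apply/negbTE; rewrite lt_eqF // expr_lt1 ?sigma_lt1 // ltW ?sigma_gt0.
Qed.

Lemma spectrum_uniq : uniq spectrum_on_points.
Proof.
have := sigma_gt0; have := sigma_lt1 => s1 s0.
rewrite /= !inE !negb_or !andbT; do ?[apply/andP; split]; apply/eqP => E; lra.
Qed.

Lemma v_neq0 : v%:R != 0 :> R.
Proof. by rewrite pnatr_eq0; lia. Qed.

Lemma card_point_sum (c : R) : \sum_(p : P) c = v%:R * c.
Proof. by rewrite sumr_const -(design_points design) mulr_natl. Qed.

Lemma component_eigen theta : theta \in spectrum_on_points ->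
  component theta *m B1 = theta *: component theta.
Proof.
move=> th; apply: lift_eigenvector => [|q].
  have := sigma_gt0; move: th; rewrite !inE => /or4P[] /eqP-> s0;
    apply/eqP => E; lra.
rewrite sum_blocks_through /point_part.
have [->|->] : theta ^+ 2 = 1 \/ theta ^+ 2 = sigma ^+ 2.
- by move: th; rewrite !inE => /or4P[] /eqP->; rewrite ?sqrrN ?expr1n; auto.
- rewrite eqxx mulr1 card_point_sum mulfV ?v_neq0 // design_count natrD natrM.
  have -> : v.-1%:R = v%:R - 1 :> R by rewrite -subn1 natrB //; lia.
  by field; exact: v_neq0.
rewrite sqr_sigma_neq1 rk_sigma sumrB card_point_sum mulfV ?v_neq0 //.
rewrite (bigD1 x) //= eqxx big1 => [|p /negPf->]; last by [].
by rewrite addr0 subrr mulr0 add0r.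
Qed.

Lemma component_sum :
  \sum_(theta <- spectrum_on_points) component theta =
  row (enum_rank (inl x : P + Bl)) 1%:M.
Proof.
have s0 : s != 0 by rewrite gt_eqF ?s_gt0.
have sg0 : sigma != 0 by rewrite gt_eqF ?sigma_gt0.
rewrite !big_cons big_nil addr0; apply/rowP => j; rewrite !mxE.
rewrite -(inj_eq (@enum_val_inj _ _)) enum_rankK.
rewrite /point_part !sqrrN expr1n eqxx sqr_sigma_neq1.
case: (enum_val j) => [q|B] /=.
  rewrite -[inl x == _]/(x == q) eq_sym; field; exact: v_neq0.
by field; rewrite s0 sg0.
Qed.

Lemma peak_from_pointE y t :
  peak_state_transfer R (incidence_graph blk) (inl x) y t <->
  [/\ inl x != y, (0 < t)%N,
      `|\sum_(theta <- spectrum_on_points)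
          cheb t theta * lift_point_function theta (point_part theta) y| =
        \sum_(theta <- spectrum_on_points)
          `|lift_point_function theta (point_part theta) y|
    & exists2 theta, theta \in spectrum_on_points
        & lift_point_function theta (point_part theta) y != 0].
Proof.
have := peak_state_transferE incidence_graph_sym degree_gt0 spectrum_uniq
  component_eigen component_sum y t.
have cE theta : component theta 0 (enum_rank y) =
    lift_point_function theta (point_part theta) y by rewrite vertex_rowE.
under [X in `|X| = _]eq_bigr do rewrite cE.
under [X in _ = X]eq_bigr do rewrite cE.
move=> ->; split=> -[xy t0 E [th sth nz]]; split=> //; exists th => //.
  by rewrite -cE.
by rewrite cE.
Qed.

Lemma sum_block_point_part theta B :
  \sum_(p in blk B) point_part theta p =
  if theta ^+ 2 == 1 then k%:R / v%:R else (x \in blk B)%:R - k%:R / v%:R.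
Proof.
rewrite /point_part; case: ifP => _.
  by rewrite sumr_const (design_block_size design) mulr_natl.
rewrite sumrB sumr_const (design_block_size design) mulr_natl; congr (_ - _).
case: (boolP (x \in blk B)) => xB.
  by rewrite (bigD1 x) //= eqxx big1 ?addr0 // => p /andP[_ /negPf->].
rewrite big1 // => p pB; case: eqP => // px.
by rewrite -px pB in xB.
Qed.

Lemma k_over_v_bounds : 0 < (k%:R / v%:R : R) < 1.
Proof.
have v0 : (0 < v%:R :> R) by rewrite ltr0n; lia.
rewrite ltr_pdivrMr // mul1r ltr_nat divr_gt0 ?ltr0n //=; lia.
Qed.

Lemma sigma_component_neq0 y : inl x != y ->
  lift_point_function sigma (point_part sigma) y != 0.
Proof.
have s0 : s != 0 by rewrite gt_eqF ?s_gt0.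
have sg0 : sigma != 0 by rewrite gt_eqF ?sigma_gt0.
case: y => [q|B] /= xy.
  have qx : (q == x) = false by rewrite eq_sym; exact: negPf xy.
  by rewrite /point_part sqr_sigma_neq1 qx sub0r mulf_neq0 ?oppr_eq0
    ?invr_eq0 ?v_neq0 ?pnatr_eq0.
rewrite sum_block_point_part sqr_sigma_neq1 mulf_neq0 ?invr_eq0 ?mulf_neq0 //.
  by have /andP[? ?] := k_over_v_bounds; apply/eqP; case: (x \in _) => /= ?; lra.
by rewrite pnatr_eq0.
Qed.

Lemma peak_from_point_cheb y t :
  peak_state_transfer R (incidence_graph blk) (inl x) y t ->
  (0 < t)%N /\ cheb t sigma ^+ 2 = 1.
Proof.
move=> /peak_from_pointE[xy t0 E _]; split=> //.
have c1 theta : theta \in spectrum_on_points -> `|cheb t theta| <= 1.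
  move=> th; apply: cheb_le1; have := sigma_gt0; have := sigma_lt1.
  move: th; rewrite !inE => /or4P[] /eqP-> ? ?;
    rewrite ?normrN ?normr1 // ger0_norm; lra.
have := norm_sum_tight c1 E (i := sigma) _ (sigma_component_neq0 xy).
by rewrite -real_normK ?num_real // !inE eqxx !orbT => ->; rewrite ?expr1n.
Qed.

(** For sigma = 1/2 the values of T_3 at 1, -1, sigma, - sigma are
    1, -1, -1, 1: exactly the signs of the four components at a block that
    avoids [x]. *)
Lemma peak_to_block_avoiding B : 4%:R * sigma ^+ 2 = 1 -> x \notin blk B ->
  peak_state_transfer R (incidence_graph blk) (inl x) (inr B) 3.
Proof.
move=> sg4 xB; apply/peak_from_pointE.
have sg0 := sigma_gt0; have s0 := s_gt0.
have sgE : sigma = 2%:R^-1.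
  apply/eqP; rewrite -(eqrXn2 (n := 2)) ?(ltW sg0) ?invr_ge0 ?ler0n //.
  by apply/eqP; rewrite exprVn; lra.
split=> //; last first.
  by exists sigma; [rewrite !inE eqxx !orbT | exact: sigma_component_neq0].
rewrite !big_cons big_nil /= !sum_block_point_part !sqrrN expr1n eqxx.
rewrite sqr_sigma_neq1 (negPf xB) sub0r !addr0 sgE.
have /andP[] := k_over_v_bounds; move: (k%:R / v%:R) => c c0 _.
move: s s0 => u u0; have u_neq0 : u != 0 by rewrite gt_eqF.
have a0 : 0 < c / (2%:R * u) by rewrite divr_gt0 // mulr_gt0 ?ltr0n.
(* The four components are a, - a, - 2 a and 2 a. *)
set a := c / (2%:R * u) in a0.
have -> : c / (2%:R * 1 * u) = a by rewrite mulr1.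
have -> : c / (2%:R * -1 * u) = - a by rewrite /a; field.
have -> : - c / (2%:R * 2%:R^-1 * u) = - (2%:R * a) by rewrite /a; field.
have -> : - c / (2%:R * - 2%:R^-1 * u) = 2%:R * a by rewrite /a; field.
have a2 : 0 < 2%:R * a by rewrite mulr_gt0 ?ltr0n.
have a6 : 0 < 6%:R * a by rewrite mulr_gt0 ?ltr0n.
rewrite [X in `|X|](_ : _ = 6%:R * a); last by field.
by rewrite big_nil addr0 !normrN !gtr0_norm //; ring.
Qed.

Lemma cheb_sigma_parameters t : (0 < t)%N -> cheb t sigma ^+ 2 = 1 ->
  (v = 3 /\ k = 2 \/ v = 9 /\ k = 3)%N.
Proof.
move=> t0 E.
(* In R, z is 4 sigma^2 - 2. *)
pose z : rat := 4%:R * ((v - k)%:R / (k * v.-1)%:R) - 2%:R.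
have zE : ratr (z / 2%:R) = 2%:R * sigma ^+ 2 - 1 :> R.
  rewrite /z sqr_sigma !(rmorphM, rmorphB, fmorphV, rmorph_nat) /= ?ratr_nat.
  by field; rewrite !pnatr_eq0; nia.
have /(cheb_rational_eq1 t0)/intrP[m Em] : cheb t (z / 2%:R) = 1.
  apply: (fmorph_inj (@ratr R)); rewrite rmorph_cheb /= zE cheb_double E.
  by rewrite rmorph1; ring.
have kv0 : (k * v.-1)%:R != 0 :> rat by rewrite pnatr_eq0; nia.
have {Em} : 4 * (v - k)%:Z = (m + 2) * (k * v.-1)%:Z.
  apply: (@intr_inj rat).
  by rewrite intrM [RHS]intrM intrD -Em /z subrK -mulrA -!pmulrn divfK.
have vk : (0 < (v - k)%:Z) by lia.
have wk : ((v - k)%:Z < v.-1%:Z) by lia.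
have kw : (2 * v.-1 <= k * v.-1)%N by rewrite leq_mul2r; lia.
move=> Em.
(* m + 2 is 4 sigma^2, which lies strictly between 0 and 2. *)
have m2 : m + 2 = 1 by nia.
move: Em; rewrite m2 mul1r => Em.
have {}Em : (4 * (v - k) = k * v.-1)%N by lia.
have k4 : (k < 4)%N by nia.
by move: k4 Em k_bounds; case: k => [|[|[|[|]]]] //; lia.
Qed.

End Eigenvectors.

End Designs.

Theorem theorem5p6 (R : realType) (P Bl : finType) (blk : Bl -> {set P})
    (v b r k lambda : nat)
    (design : block_design blk v b r k lambda) (k_bounds : 1 < k < v) :
  (exists (x : P) (y : (P + Bl)%type) (t : nat),
     peak_state_transfer R (incidence_graph blk) (inl x) y t) <->
  (v = 3 /\ k = 2) \/ (v = 9 /\ k = 3).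
Proof.
split=> [[x [y [t /(peak_from_point_cheb design k_bounds)[t0]]]]|vk].
  exact: cheb_sigma_parameters.
have /card_gt0P[x _] : 0 < #|P| by rewrite (design_points design); lia.
have [B xB] := exists_block_avoiding design k_bounds x.
exists x, (inr B), 3; apply: (peak_to_block_avoiding design k_bounds) => //.
by rewrite sqr_sigma mulrA -natrM; case: vk => -[-> ->];
   apply: divff; rewrite pnatr_eq0.
Qed.
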